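(* Let $A$ be an abelian group of order $n$. Then the ratio of the number of isomorphism classes of digraphs that are DRRs on $A$ (i.e. isomorphic to some DRR $\mathrm{Cay}(A,S)$) to the number of isomorphism classes of Cayley digraphs on $A$ tends to $1$ as $n\to\infty$.
   Context: All groups and digraphs are finite. A digraph is a pair $(V,R)$ with $V$ finite nonempty and $R\subseteq V\times V$ (loops allowed). For a group $G$ and $S\subseteq G$, the Cayley digraph $\mathrm{Cay}(G,S)$ has vertex set $G$, with $(g,h)$ an arc iff $gh^{-1}\in S$. It is a DRR if its full automorphism group equals the right regular action of $G$ on itself. Unlabeled digraphs are isomorphism classes of digraphs. *)

(* Defs.v *)
From HB Require Import structures.
From mathcomp Require Import all_boot all_order all_algebra all_fingroup.
Set Implicit Arguments. Unset Strict Implicit. Unset Printing Implicit Defensive.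
Import Order.TTheory GRing.Theory Num.Theory.

Section Cayley.
Variable gT : finGroupType.
Local Open Scope group_scope.

(* Arc relation of the Cayley digraph Cay(G,S) on vertex set gT:
   (g,h) is an arc iff g h^-1 \in S (loops allowed). *)
Definition cay_arc (S : {set gT}) (g h : gT) : bool := (g * h^-1) \in S.

Definition cay_isom (S T : {set gT}) (p : {perm gT}) : bool :=
  [forall g, forall h, cay_arc T (p g) (p h) == cay_arc S g h].

Definition cay_iso (S T : {set gT}) : bool := [exists p : {perm gT}, cay_isom S T p].

Definition cay_aut (S : {set gT}) : {set {perm gT}} := [set p | cay_isom S S p].

Definition right_regular : {set {perm gT}} :=
  [set perm (@mulIg gT a) | a : gT].

Definition is_DRR (S : {set gT}) : bool := cay_aut S == right_regular.

Definition cay_class (S : {set gT}) : {set {set gT}} := [set T | cay_iso S T].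

Definition cayley_classes : {set {set {set gT}}} :=
  [set cay_class S | S : {set gT}].

Definition DRR_classes : {set {set {set gT}}} :=
  [set cay_class S | S in [set S : {set gT} | is_DRR S]].

End Cayley.

(* Main.v *)
(* If Cay(A,S) is not a DRR, let R be the right regular copy of A and G a minimal
   group with R < G <= Aut Cay(A,S).  If R is normal in G, a nontrivial
   automorphism of A preserves S.  Otherwise R meets its other conjugates in
   Z = C_R(G), and the conjugates of R \ Z fill exactly the complement in G of
   N = PZ, where P is the stabiliser of 1; so N is normal.  Since P is core-free
   and N' = P', N is abelian.  The set Q of all commutators [y, a] with y in N is a
   subgroup which does not depend on a in R \ Z, and H = PQ :&: Z is nontrivial;
   hence S \ Z is a union of H-cosets, and S is preserved by the permutation that
   is multiplication by some h <> 1 of H off Z and the identity on Z.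

   In both cases S is stable under one of at most n^(log n + 2) permutations, each
   moving at least half of the n points and so having at most 3n/4 orbits: at most
   n^(log n + 2) 2^(3n/4) sets S are not DRRs.  An isomorphism class of DRRs is an
   Aut(A)-orbit, of size at most n^(log n), so there are at least about
   2^n / n^(log n) DRR classes, which outnumber the other classes. *)
Require Import Defs.
From HB Require Import structures.
From mathcomp Require Import all_boot all_order all_algebra all_fingroup.
From mathcomp Require Import all_solvable zify.
Set Implicit Arguments. Unset Strict Implicit. Unset Printing Implicit Defensive.
Import GroupScope.

(** * Abelian maximal subgroups *)

Section MaximalAbelian.

Variables (gT : finGroupType) (G A P : {group gT}).
Hypotheses (maxA : maximal A G) (cAA : abelian A) (nnA : ~~ (A <| G)).

Let sAG : A \subset G.
Proof. by case/maxgroupP: maxA => /andP[]. Qed.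

Lemma maximal_between (M : {group gT}) :
  A \subset M -> M \subset G -> M = A :> {set gT} \/ M = G :> {set gT}.
Proof.
move=> sAM sMG; case/maxgroupP: maxA => _ max_A.
have [->|neMG] := eqVneq (M : {set gT}) G; first by right.
by left; apply: max_A; rewrite // properEneq neMG.
Qed.

Lemma norm_maximal_abelian : 'N_G(A) = A.
Proof.
have sANA : A \subset 'N_G(A) by rewrite subsetI sAG normG.
have [//|defG] := maximal_between sANA (subsetIl _ _).
by case/negP: nnA; rewrite /normal sAG -{1}defG subsetIr.
Qed.

(** By maximality ['C_G[a]] is [A] or [G]. In the first case [A :^ g^-1], which centralises [a],
    lies in [A], so [g] normalises [A], against [norm_maximal_abelian]. *)
Lemma maximal_abelian_meet (g a : gT) :
  g \in G -> g \notin A -> a \in A -> a ^ g \in A -> a \in 'C(G).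
Proof.
move=> Gg nAg Aa Aag.
have sAC : A \subset 'C_G[a] by rewrite subsetI sAG sub_cent1 (subsetP cAA).
have [defC|<-] := maximal_between sAC (subsetIl _ _); last first.
  by rewrite -sub_cent1 subsetIr.
case/negP: nAg; rewrite -norm_maximal_abelian inE Gg -groupV.
apply/normP/eqP; rewrite eqEcard cardJg leqnn andbT.
rewrite -{2}defC subsetI; apply/andP; split.
  by rewrite conj_subG // groupV.
rewrite sub_cent1; apply/centP=> _ /imsetP[b Ab ->]; rewrite /commute.
apply: (conjg_inj g); rewrite (conjMg a) (conjMg _ a) conjgKV.
by rewrite (centsP cAA _ Aag).
Qed.

Let Z := 'C_A(G).

(** Distinct conjugates of [A :\: Z] are thus disjoint, which allows their union to be counted. *)
Lemma normedTI_maximal_abelian : normedTI (A :\: Z) G A.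
Proof.
apply/normedTI_memJ_P; split=> //.
  rewrite setD_eq0; apply: contra nnA => sAZ; rewrite /normal sAG.
  by rewrite cents_norm // centsC (subset_trans sAZ) ?subsetIr.
move=> a g /setDP[Aa nZa] Gg; apply/idP/idP=> [|Ag]; last first.
  by rewrite /conjg (centsP cAA a Aa g Ag) mulKg inE nZa.
case/setDP=> Aag _; apply: contraR nZa => nAg.
by rewrite inE Aa (maximal_abelian_meet Gg).
Qed.

Hypotheses (defG : A * P = G) (tiAP : A :&: P = 1).
Hypothesis coreP : forall Q : {group gT}, Q \subset P -> Q <| G -> Q :=: 1.

Let sPG : P \subset G. Proof. by rewrite -defG mulG_subr. Qed.
Let sZG : Z \subset G. Proof. by rewrite subIset ?sAG. Qed.
Let cGZ : G \subset 'C(Z). Proof. by rewrite centsC subsetIr. Qed.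
Let cPZ : P \subset 'C(Z). Proof. exact: subset_trans cGZ. Qed.
Let N := P <*> Z.
Let defN : N = P * Z.
Proof. by rewrite /N norm_joinEr // cents_norm // centsC. Qed.
Let tiPZ : P :&: Z = 1.
Proof.
have: Z :&: P \subset A :&: P by rewrite setSI ?subsetIl.
by rewrite tiAP setIC => /trivgP.
Qed.
Let sNG : N \subset G. Proof. by rewrite join_subG sPG. Qed.
Let tiAN : A :&: N = Z.
Proof. by rewrite defN -group_modr ?subsetIl // tiAP mul1g. Qed.

(* The conjugates of [A :\: Z] leave exactly [#|P| * #|Z| = #|N|] elements of [G],
   as in the definition of a Frobenius kernel; hence [N] is normal. *)
Let defNc : N = G :\: class_support (A :\: Z) G.
Proof.
apply/eqP; rewrite eqEcard; apply/andP; split.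
  rewrite subsetD sNG disjoints_subset; apply/subsetP=> n Nn; rewrite inE.
  apply: contraL Nn => /imset2P[b g /setDP[Ab nZb] Gg ->].
  have: g \in A * P by rewrite defG.
  case/mulsgP=> a x Aa Px ->; rewrite conjgM groupJr; last first.
    by rewrite (subsetP (joing_subl _ _)).
  rewrite /conjg (centsP cAA b Ab a Aa) mulKg.
  by apply: contra nZb => Nb; rewrite -tiAN inE Ab.
rewrite cardsD (setIidPr _); last first.
  by rewrite class_support_subG // (subset_trans (subsetDl _ _)).
(* The support has [(#|A| - #|Z|) * #|P|] elements, since [#|G : A| = #|P|]. *)
rewrite (card_support_normedTI normedTI_maximal_abelian) cardsD.
have cardG : #|G| = (#|A| * #|P|)%N by rewrite -defG TI_cardMg.
rewrite (setIidPr (subsetIl _ _)) -divgS // cardG mulKn ?cardG_gt0 //.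
have leZA : #|Z| <= #|A| by rewrite subset_leq_card ?subsetIl.
rewrite defN TI_cardMg // mulnBl subKn; first by rewrite mulnC.
by rewrite leq_mul2r leZA orbT.
Qed.

Let nNG : G \subset 'N(N).
Proof.
rewrite defNc; apply/normsD; [exact: normG | exact: class_support_norm].
Qed.

Let cNN : abelian N.
Proof.
have defPZ : P \* Z = N by rewrite cprodEY // centsC.
have abZ : abelian Z by rewrite (abelianS _ cAA) ?subsetIl.
(* [N] is the central product of [P] and the abelian [Z]. The derived group of [P] is therefore
   normal in [G], and [coreP] kills it. *)
have defP' : P^`(1) = N^`(1).
  by have := der_cprod 1 defPZ; rewrite (derG1P abZ) cprodg1.
have nsN : N <| G by rewrite /normal sNG.
have P'1 : P^`(1) :=: 1.
  apply: coreP; first exact: der_sub.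
  by rewrite /= defP' (char_normal_trans (der_char 1 _)).
by apply/derG1P; rewrite -defP'.
Qed.

(** As [N] is abelian and normal, [y |-> [~ y, a]] is an endomorphism of [N], so its image is a
    group. *)
Let Q a := [set [~ y, a] | y in N].

Let mem_Q a y : a \in G -> y \in N -> [~ y, a] \in N.
Proof.
move=> Ga Ny; rewrite commgEl groupMl ?groupV //.
by rewrite memJ_norm // (subsetP nNG).
Qed.

Let Q_mulr a y z : y \in N -> z \in N -> a \in G ->
  [~ y * z, a] = [~ y, a] * [~ z, a].
Proof.
move=> Ny Nz Ga; rewrite commMgJ; congr (_ * _).
by rewrite /conjg (centsP cNN _ (mem_Q Ga Ny) _ Nz) mulKg.
Qed.

Let Q_group_set a : a \in G -> group_set (Q a).
Proof.
move=> Ga; apply/group_setP; split.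
  by apply/imsetP; exists 1; rewrite ?group1 // comm1g.
move=> _ _ /imsetP[y Ny ->] /imsetP[z Nz ->]; rewrite -Q_mulr //.
by apply: imset_f; rewrite groupM.
Qed.

(** Here [a^-1 ^ y = [~ y, a] * a^-1] lies in [A]; if [y] were outside [A], then
    [maximal_abelian_meet] would make [a] central. So [y] is in [A :&: N = Z]. *)
Let Q_kernel a y : a \in A :\: Z -> y \in N -> [~ y, a] \in Z -> y \in Z.
Proof.
move=> A'a Ny Zya; have [Aa nZa] := setDP A'a.
have Gy := subsetP sNG y Ny.
rewrite -tiAN inE Ny andbT; apply: contraR nZa => nAy.
rewrite inE Aa -groupV (maximal_abelian_meet Gy nAy) ?groupV //.
have ->: a^-1 ^ y = [~ y, a] * a^-1 by rewrite commgEr mulgK.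
by rewrite groupM ?groupV //; case/setIP: Zya.
Qed.

Let Q_meet a x : a \in A :\: Z -> x \in Q a -> x \in Z -> x = 1.
Proof.
move=> A'a /imsetP[y Ny ->] Zya; apply/eqP/commgP.
have Zy := Q_kernel A'a Ny Zya; have [Aa _] := setDP A'a.
by apply/commute_sym/(centsP cGZ); rewrite ?(subsetP sAG).
Qed.

Let Q_norm a b : a \in A -> b \in A -> b \in 'N(Q a).
Proof.
move=> Aa Ab; have Gb := subsetP sAG b Ab.
rewrite inE; apply/subsetP=> _ /imsetP[_ /imsetP[y Ny ->] ->].
rewrite conjRg {2}/conjg (centsP cAA a Aa b Ab) mulKg.
by apply: imset_f; rewrite memJ_norm // (subsetP nNG).
Qed.

(* [x |-> [~ x, b]] is injective on [Q a], hence onto [Q a], with image in [Q b]. *)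
Let Q_subset a b : a \in A :\: Z -> b \in A :\: Z -> Q a \subset Q b.
Proof.
move=> A'a A'b; have [Aa _] := setDP A'a; have [Ab _] := setDP A'b.
have [Ga Gb] := (subsetP sAG a Aa, subsetP sAG b Ab).
have QaN : Q a \subset N.
  by apply/subsetP=> _ /imsetP[y Ny ->]; apply: mem_Q.
pose Qa := group (Q_group_set Ga).
suff <-: [set [~ x, b] | x in Q a] = Q a.
  by apply: imsetS.
apply/eqP; rewrite eqEcard; apply/andP; split.
  apply/subsetP=> _ /imsetP[x Qx ->]; rewrite -[Q a]/(gval Qa).
  by rewrite commgEl groupMl ?groupV //= memJ_norm // Q_norm.
rewrite card_in_imset // => x x' Qx Qx' eqx.
(* The quotient commutes with [b], so [Q_kernel] puts it in [Z], and [Q_meet] makes it trivial. *)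
have Qw : x * x'^-1 \in Qa by rewrite groupM ?groupV.
have [Nw Nx'] := (subsetP QaN _ Qw, subsetP QaN _ Qx').
have w1: [~ x * x'^-1, b] = 1.
  by apply: (mulIg [~ x', b]); rewrite -Q_mulr // mulgKV mul1g.
apply: (mulIg x'^-1); rewrite mulgV (Q_meet A'a Qw) //.
by apply: (Q_kernel A'b); rewrite // w1 group1.
Qed.

(* In the action of [G] on the cosets of [P], identified with [A], this says that
   the orbits of [P] off ['C_A(G)] are unions of cosets of [H]. *)
Lemma maximal_abelian_generalized_wreath :
  exists H : {group gT}, [/\ H \subset 'C_A(G), H :!=: 1 &
    forall a h, a \in A :\: 'C_A(G) -> h \in H -> h * a \in P :* a * P].
Proof.
have [a0 A'a0] : exists a, a \in A :\: Z.
  by apply/set0Pn; case/normedTI_P: normedTI_maximal_abelian.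
have [Aa0 nZa0] := setDP A'a0; have Ga0 := subsetP sAG _ Aa0.
pose Q0 := group (Q_group_set Ga0).
have sQN : Q0 \subset N.
  by apply/subsetP=> _ /imsetP[y Ny ->]; apply: mem_Q.
have sPN : P \subset N by apply: joing_subl.
have nQG : Q0 <| G.
  rewrite /normal (subset_trans sQN) //= -defG mul_subG //.
    by apply/subsetP=> b Ab; apply: Q_norm.
  by rewrite cents_norm // centsC (subset_trans sQN) // (subset_trans cNN) // centS.
have cPQ : Q0 \subset 'C(P).
  by rewrite (subset_trans sQN) // (subset_trans cNN) // centS.
exists ((P <*> Q0) :&: Z)%G; split; first exact: subsetIr.
  (* If [H] is trivial, comparing orders inside [N = P * Z] gives [Q0 \subset P]. Then [coreP]
     yields [Q0 = 1], so [a0] centralises [P] as well as [A], hence [G]. *)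
  apply: contra nZa0 => /eqP tiH.
  have eqPQ : P :=: P <*> Q0.
    apply/eqP; rewrite eqEcard joing_subl /= -(leq_pmul2r (cardG_gt0 'C_A(G))).
    have: (P <*> Q0) * Z \subset N by rewrite mul_subG ?join_subG ?sPN ?joing_subr.
    move/subset_leq_card; rewrite TI_cardMg // defN TI_cardMg //.
  have sQP : Q0 \subset P by rewrite eqPQ joing_subr.
  have Q1 := coreP sQP nQG.
  rewrite inE Aa0 -defG centM inE (subsetP cAA) //=.
  apply/centP=> y Py; apply/commute_sym/commgP/eqP/set1gP.
  by rewrite -Q1 /=; apply: imset_f; rewrite (subsetP sPN).
move=> a h A'a /setIP[PQh Zh].
have Aa := proj1 (setDP A'a).
have A'a' : a^-1 \in A :\: Z by rewrite inE !groupV -in_setD.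
have: h \in P * Q0 by rewrite -norm_joinEr ?cents_norm.
(* By [Q_subset], [q] is also a commutator with [a^-1]. Dropping the central factor of [y] leaves
   [h * a = (x * y1^-1) * a * y1]. *)
case/mulsgP=> x q Px /(subsetP (Q_subset A'a0 A'a'))/imsetP[y].
rewrite defN => /mulsgP[y1 z Py1 Zz ->] -> ->.
have ->: [~ y1 * z, a^-1] = [~ y1, a^-1].
  have Ga' : a^-1 \in G by rewrite groupV (subsetP sAG).
  rewrite Q_mulr ?(subsetP sPN y1 Py1) ?(subsetP (joing_subr _ _) z Zz) //.
  suff /eqP->: [~ z, a^-1] == 1 by rewrite mulg1.
  exact/commgP/commute_sym/(centsP cGZ).
have ->: x * [~ y1, a^-1] * a = x * y1^-1 * a * y1.
  by rewrite commgEl /conjg invgK !mulgA mulgKV.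
by rewrite mem_mulg // mem_rcoset mulgK groupM ?groupV.
Qed.

End MaximalAbelian.

(** * Sets stable under a permutation moving half of the points *)

(** A stable set is the union of the orbits it contains. *)
Lemma card_stable_sets (T : finType) (s : {perm T}) :
  #|[set S : {set T} | s @: S == S]| <= 2 ^ #|porbits s|.
Proof.
rewrite -card_powerset.
pose f (S : {set T}) := [set X in porbits s | X \subset S].
rewrite -(card_in_imset (f := f)); last first.
  suff fK (S : {set T}) : s @: S == S -> cover (f S) = S.
    by move=> S1 S2; rewrite !inE => /fK {2}<- /fK {2}<- ->.
  move=> /eqP sS; apply/setP=> x; apply/bigcupP/idP.
    by case=> X; rewrite inE => /andP[_ /subsetP sXS] /sXS.
  move=> Sx; exists (porbit s x); last exact: porbit_id.
  rewrite inE imset_f //=; apply/subsetP=> _ /porbitP[i ->].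
  elim: i => [|i IHi]; first by rewrite expg0 perm1.
  by rewrite expgSr permM -sS imset_f.
apply: subset_leq_card; apply/subsetP=> _ /imsetP[S _ ->].
by rewrite powersetE; apply/subsetP=> X; rewrite inE => /andP[].
Qed.

(** Every orbit has at least two points, except the singletons, which are the fixed points. *)
Lemma card_porbits_fix (T : finType) (s : {perm T}) :
  2 * #|porbits s| <= #|T| + #|[set x | s x == x]|.
Proof.
have <-: \sum_(X in porbits s) #|X| = #|T|.
  rewrite -cardsT; apply/esym/card_partition.
  have acts_s : [acts <[s]>, on [set: T] | 'P].
    by apply/actsP=> a _ x; rewrite !inE.
  have := orbit_partition acts_s; congr (partition _ _).
  by apply/setP=> X; apply/imsetP/imsetP=> -[x _ ->]; exists x; rewrite ?inE ?porbitE.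
rewrite mulnC -sum_nat_const.
have le1 : \sum_(X in porbits s) 2 <=
    \sum_(X in porbits s) #|X| + \sum_(X in porbits s) (#|X| == 1%N).
  rewrite -big_split leq_sum //= => _ /imsetP[x _ ->].
  by case: #|_| (card_porbit_neq0 s x) => [|[|m]].
apply: leq_trans le1 _; rewrite leq_add2l.
have ->: \sum_(X in porbits s) (#|X| == 1%N) = #|[set X in porbits s | #|X| == 1%N]|.
  by rewrite -sum1dep_card big_mkcondr; apply: eq_bigr => X _; case: eqP.
have inj1 : injective (@set1 T) by apply: set1_inj.
rewrite -(card_imset _ inj1); apply: subset_leq_card; apply/subsetP=> X.
rewrite inE => /andP[/imsetP[x _ ->]] /cards1P[y porb_y].
have xy : x = y by apply/set1P; rewrite -porb_y porbit_id.
apply/imsetP; exists y => //; rewrite inE.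
by apply/eqP/set1P; rewrite -porb_y -xy (mem_porbit s 1).
Qed.

Lemma card_stable_sets_half (T : finType) (s : {perm T}) :
    2 * #|[set x | s x == x]| <= #|T| ->
  #|[set S : {set T} | s @: S == S]| <= 2 ^ (3 * #|T| %/ 4).
Proof.
move=> fix_s; apply: leq_trans (card_stable_sets s) _.
rewrite leq_exp2l // leq_divRL //.
have := card_porbits_fix s.
lia.
Qed.

(** * Counting subgroups, automorphisms and half-moving permutations *)

Lemma double_card_proper (gT : finGroupType) (H G : {group gT}) :
  H \proper G -> 2 * #|H| <= #|G|.
Proof.
move=> /andP[sHG nsGH]; rewrite -(Lagrange sHG) mulnC leq_pmul2l ?cardG_gt0 //.
by rewrite indexg_gt1.
Qed.

(** Induction through a maximal subgroup: one element outside it suffices to generate [G], and the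
    order at least doubles. *)
Lemma exists_small_generating_seq (gT : finGroupType) (G : {group gT}) :
  exists s : seq gT, <<[set x in s]>> = G /\ 2 ^ size s <= #|G|.
Proof.
have [n] := ubnP #|G|; elim: n G => // n IHn G /ltnSE leGn.
have [->|ntG] := eqVneq (G : {set gT}) 1.
  exists [::]; rewrite cards1; split=> //.
  by apply/trivgP; rewrite gen_subG; apply/subsetP=> x; rewrite inE.
have [M maxM _] := @maxgroup_exists _ (fun M => M \proper G) 1%G
  (etrans (proper1G G) ntG).
have prM := maxgroupp maxM; have [sMG [x Gx nMx]] := properP prM.
have [s [gen_s le_s]] := IHn M (leq_trans (proper_card prM) leGn).
exists (x :: s); split; last first.
  by rewrite /= expnS (leq_trans _ (double_card_proper prM)) // leq_mul2l.
have sub_s : M \subset <<[set y in x :: s]>>.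
  by rewrite -gen_s genS //; apply/subsetP=> y; rewrite !inE => ->; rewrite orbT.
have sG : <<[set y in x :: s]>> \subset G.
  rewrite gen_subG; apply/subsetP=> y; rewrite !inE => /predU1P[->//|sy].
  by rewrite (subsetP sMG) // -gen_s mem_gen ?inE.
apply/eqP; rewrite eqEproper sG; apply: contra nMx => prx.
have /maxgroupP[_ maxM'] := maxM.
have <- : <<[set y in x :: s]>> = M by apply: maxM'.
by rewrite mem_gen // !inE eqxx.
Qed.

(** Padding with [1] fixes the length, so that tuples can count subgroups and automorphisms. *)
Lemma exists_generating_tuple (gT : finGroupType) (G : {group gT}) :
  exists t : (trunc_log 2 #|gT|).-tuple gT, <<[set x in t]>> = G.
Proof.
have [s [gen_s le_s]] := exists_small_generating_seq G.
have le_sk : size s <= trunc_log 2 #|gT|.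
  by rewrite trunc_log_max // (leq_trans le_s) ?max_card.
pose t := s ++ nseq (trunc_log 2 #|gT| - size s) 1.
have size_t : size t == trunc_log 2 #|gT|.
  by rewrite size_cat size_nseq subnKC.
exists (Tuple size_t); rewrite -gen_s; apply/eqP; rewrite eqEsubset.
rewrite !gen_subG; apply/andP; split; apply/subsetP=> x; rewrite !inE.
  rewrite mem_cat => /orP[sx|/nseqP[-> _]]; last exact: group1.
  by rewrite mem_gen ?inE.
by move=> sx; rewrite mem_gen // !inE mem_cat sx.
Qed.

Lemma card_groups_le (gT : finGroupType) :
  #|{group gT}| <= #|gT| ^ trunc_log 2 #|gT|.
Proof.
rewrite -card_tuple.
pose f (t : (trunc_log 2 #|gT|).-tuple gT) := <<[set x in t]>>%G.
rewrite -cardsT; apply: leq_trans (leq_imset_card f predT).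
apply/subset_leq_card/subsetP=> G _.
have [t gen_t] := exists_generating_tuple G.
by apply/imsetP; exists t => //; apply: val_inj.
Qed.

Lemma card_Aut_le (gT : finGroupType) (G : {group gT}) :
  #|Aut G| <= #|gT| ^ trunc_log 2 #|gT|.
Proof.
have [t gen_t] := exists_generating_tuple G.
pose f (a : {perm gT}) := [tuple of map a t].
rewrite -card_tuple -(card_in_imset (f := f)) ?max_card // => a b Aa Ab eqab.
have [aM bM] := (morphicP (Aut_morphic Aa), morphicP (Aut_morphic Ab)).
(* Two automorphisms agree on a subgroup; if it contains the generators, it is all of [G]. *)
have gE : group_set [set x in G | a x == b x].
  apply/group_setP; split=> [|x y].
    by rewrite inE group1 -(autmE Aa) -(autmE Ab) !morph1 /=.
  rewrite !inE => /andP[Gx /eqP ax] /andP[Gy /eqP ay].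
  by rewrite groupM //= aM // bM // ax ay.
apply: (eq_Aut Aa Ab) => x; rewrite -{1}gen_t => Gx.
suff: x \in group gE by rewrite inE => /andP[_ /eqP].
apply: subsetP Gx; rewrite gen_subG; apply/subsetP=> y; rewrite !inE => ty.
rewrite -gen_t mem_gen ?inE //=.
by move/(congr1 val)/eq_in_map: eqab => ->.
Qed.

(* The guard on [h] is only there to get a bijection for every [h]. *)
Definition off_shift_fun (gT : finGroupType) (K : {group gT}) (h x : gT) :=
  if (x \in K) || (h \notin K) then x else h * x.

Lemma off_shift_inj (gT : finGroupType) (K : {group gT}) (h : gT) :
  injective (off_shift_fun K h).
Proof.
move=> x y; rewrite /off_shift_fun; have [Kh|_] := boolP (h \in K); last by rewrite !orbT.
rewrite !orbF; case: ifPn => Kx; case: ifPn => Ky //; last exact: mulgI.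
- by move=> def_x; move: Ky; rewrite -(groupMl _ Kh) -def_x Kx.
- by move=> def_y; move: Kx; rewrite -(groupMl _ Kh) def_y Ky.
Qed.

Definition off_shift (gT : finGroupType) (K : {group gT}) (h : gT) : {perm gT} :=
  perm (@off_shift_inj gT K h).

Lemma off_shift_fix (gT : finGroupType) (K : {group gT}) (h : gT) :
  h \in K -> h != 1 -> [set x | off_shift K h x == x] = K.
Proof.
move=> Kh nt_h; apply/setP=> x; rewrite inE permE /off_shift_fun Kh orbF.
by case: ifP => _; rewrite ?eqxx // -{2}(mul1g x) (can_eq (mulgK x)) (negPf nt_h).
Qed.

Lemma Aut_fix_group_set (gT : finGroupType) (a : {perm gT}) :
  a \in Aut [set: gT] -> group_set [set x | a x == x].
Proof.
move=> Aa; have aM := morphicP (Aut_morphic Aa).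
apply/group_setP; split=> [|x y]; first by rewrite inE -(autmE Aa) morph1.
by rewrite !inE => /eqP ax /eqP ay; rewrite aM ?inE // ax ay.
Qed.

(** The two kinds serve the normal and the non-normal case. In both, the fixed points form a proper
    subgroup, hence at most half of the group. *)
Definition half_moving_perms (gT : finGroupType) : {set {perm gT}} :=
  (Aut [set: gT])^# :|:
  [set off_shift u.1 u.2 | u in [pred u : {group gT} * gT |
     [&& u.1 \proper [set: gT], u.2 \in u.1 & u.2 != 1]]].

Lemma card_half_moving_perms (gT : finGroupType) :
  #|half_moving_perms gT| <= #|gT| ^ (trunc_log 2 #|gT|).+2.
Proof.
set k := trunc_log 2 _; set n := #|gT|.
have n_gt0 : 0 < n by rewrite /n -cardsT cardG_gt0.
(* Strictness, gained by removing the identity, matters when [n = 1]. *)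
have le1 : (#|(Aut [set: gT])^#| < n ^ k)%N.
  apply: leq_trans (card_Aut_le [set: gT]%G).
  by rewrite [X in (_ < X)%N](cardsD1 1) group1.
have le2 : (#|half_moving_perms gT| <= #|(Aut [set: gT])^#| + n ^ k * n)%N.
  apply: leq_trans (leq_card_setU _ _) _; rewrite leq_add2l.
  apply: leq_trans (leq_imset_card _ _) _; apply: leq_trans (max_card _) _.
  by rewrite card_prod leq_mul2r card_groups_le orbT.
rewrite !expnS; move: n n_gt0 le1 le2 => {}n n_gt0 le1 le2.
have [n1|] := leqP n 1; last by move: (n ^ k)%N le1 le2 => m le1 le2; nia.
have n_eq1 : n = 1%N by lia.
by move: le1 le2; rewrite n_eq1 exp1n; lia.
Qed.

Lemma half_moving_perms_fix (gT : finGroupType) (s : {perm gT}) :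
  s \in half_moving_perms gT -> 2 * #|[set x | s x == x]| <= #|gT|.
Proof.
rewrite -cardsT; case/setUP=> [/setD1P[nt_s As]|/imsetP[[K h]]].
  apply: (@double_card_proper _ (group (Aut_fix_group_set As)) [set: gT]%G).
  rewrite properEneq subsetT andbT; apply: contra nt_s => /eqP fixT.
  apply/eqP/permP=> x; apply/eqP; rewrite perm1.
  by have := in_setT x; rewrite -fixT inE.
rewrite inE /= => /and3P[prK Kh nt_h] ->.
by rewrite off_shift_fix //; apply: double_card_proper.
Qed.

(** * Automorphisms of Cayley digraphs *)

Section CayleyAutomorphisms.

Variable gT : finGroupType.
Implicit Types (S T : {set gT}) (p : {perm gT}).

Let r (a : gT) : {perm gT} := perm (@mulIg gT a).

Let rE a x : r a x = x * a. Proof. exact: permE. Qed.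

Let rM a b : r (a * b) = r a * r b.
Proof. by apply/permP=> x; rewrite permM !rE mulgA. Qed.

Let rV a : r a^-1 = (r a)^-1.
Proof.
apply: (mulgI (r a)); rewrite mulgV -rM mulgV.
by apply/permP=> x; rewrite rE mulg1 perm1.
Qed.

Lemma right_regularP p : reflect (exists a, p = r a) (p \in right_regular gT).
Proof.
by apply: (iffP imsetP) => [[a _ ->] | [a ->]]; exists a.
Qed.

Let r_regular a : r a \in right_regular gT.
Proof. by apply/right_regularP; exists a. Qed.

Lemma right_regular_group_set : group_set (right_regular gT).
Proof.
apply/group_setP; split=> [|_ _ /right_regularP[a ->] /right_regularP[b ->]].
  by apply/right_regularP; exists 1; apply/permP=> x; rewrite rE mulg1 perm1.
by rewrite -rM.
Qed.
Canonical right_regular_group := group right_regular_group_set.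

Lemma cay_isomP S T p :
  reflect (forall g h, cay_arc T (p g) (p h) = cay_arc S g h) (cay_isom S T p).
Proof.
apply: (iffP forallP) => [isoP g h | isoP g]; first by have /forallP/(_ h)/eqP := isoP g.
by apply/forallP=> h; rewrite isoP.
Qed.

Lemma cay_isomM S T U p q :
  cay_isom S T p -> cay_isom T U q -> cay_isom S U (p * q).
Proof. by move=> /cay_isomP pP /cay_isomP qP; apply/cay_isomP=> g h; rewrite !permM qP. Qed.

Lemma cay_isomV S T p : cay_isom S T p -> cay_isom T S p^-1.
Proof. by move=> /cay_isomP pP; apply/cay_isomP=> g h; rewrite -pP !permKV. Qed.

Lemma cay_aut_group_set S : group_set (cay_aut S).
Proof.
apply/group_setP; split=> [|p q].
  by rewrite inE; apply/cay_isomP=> g h; rewrite !perm1.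
by rewrite !inE; apply: cay_isomM.
Qed.
Canonical cay_aut_group S := group (cay_aut_group_set S).

Lemma right_regular_sub_cay_aut S : right_regular gT \subset cay_aut S.
Proof.
apply/subsetP=> _ /right_regularP[a ->]; rewrite inE; apply/cay_isomP=> g h.
by rewrite /cay_arc !rE invMg mulgA mulgK.
Qed.

(** The connection set consists of the vertices with an arc to [1]. *)
Lemma cay_isom_imset S T p : cay_isom S T p -> p 1 = 1 -> T = p @: S.
Proof.
move=> /cay_isomP pP p1; apply/setP=> x.
have := pP (p^-1 x) 1; rewrite /cay_arc p1 permKV invg1 !mulg1 => ->.
by rewrite -[in RHS](permKV p x) mem_imset //; apply: perm_inj.
Qed.

(** Conjugation by [p] turns translation by [y] into translation by some [b]; evaluation at [1]
    gives [b = p y]. *)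
Lemma norm_right_regular_Aut p :
  p \in 'N(right_regular gT) -> p 1 = 1 -> p \in Aut [set: gT].
Proof.
move=> np p1; rewrite inE; apply/andP; split.
  by apply/subsetP=> x; rewrite inE.
apply/morphicP=> x y _ _.
have: r y ^ p \in right_regular gT by rewrite memJ_norm.
case/right_regularP=> b def_b.
have ryE z : p (z * y) = p z * b.
  have := congr1 (fun s : {perm gT} => s (p z)) def_b.
  by rewrite rE /conjg !permM permK rE.
by rewrite ryE; congr (_ * _); rewrite -[y]mul1g ryE p1 mul1g.
Qed.

Hypothesis abT : abelian [set: gT].

Let cT (a b : gT) : a * b = b * a.
Proof. by apply: (centsP abT); rewrite inE. Qed.

Lemma right_regular_abelian : abelian (right_regular gT).
Proof.
apply/centsP=> _ /right_regularP[a ->] _ /right_regularP[b ->].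
by rewrite /commute -!rM cT.
Qed.

Lemma nonDRR_stable S :
  ~~ is_DRR S -> exists2 s, s \in half_moving_perms gT & s @: S == S.
Proof.
rewrite /is_DRR eq_sym => neqRS.
have prRS : right_regular gT \proper cay_aut S.
  by rewrite properEneq neqRS right_regular_sub_cay_aut.
have [G minG sGS] := @mingroup_exists _ (fun G => right_regular gT \proper G)
  (cay_aut_group S) prRS.
have /mingroupP[prRG min_G] := minG.
have sRG := proper_sub prRG.
(* Minimality of [G] above the regular group makes that group maximal in [G]. *)
have maxR : maximal right_regular_group G.
  apply/maxgroupP; split=> // M prMG sRM; apply/eqP; rewrite eq_sym eqEproper sRM.
  apply/negP=> prRM; have := proper_subn prMG.
  by rewrite (min_G M) ?(proper_sub prMG) ?subxx.
have fixS p : p \in G -> p 1 = 1 -> S = p @: S.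
  by move=> /(subsetP sGS); rewrite inE; apply: cay_isom_imset.
pose P := 'C_G[1%g | 'P]%G.
have memP p : (p \in P) = (p \in G) && (p 1 == 1).
  by rewrite inE; congr (_ && _); rewrite (sameP astab1P eqP).
have defG : right_regular_group * P = G.
  apply/eqP; rewrite eqEsubset mul_subG ?subsetIl //; apply/subsetP=> g Gg.
  pose a := (g^-1 1)^-1; apply/mulsgP; exists (r a) (r a^-1 * g); first exact: r_regular.
    rewrite memP groupM ?(subsetP sRG _ (r_regular _)) //=.
    by rewrite permM rE mul1g invgK permKV.
  by rewrite rV mulKVg.
have tiRP : right_regular_group :&: P = 1.
  apply/trivgP/subsetP=> p /setIP[/right_regularP[b ->]]; rewrite memP => /andP[_].
  rewrite rE mul1g => /eqP->; apply/set1P/permP=> x.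
  by rewrite rE mulg1 perm1.
have [nRG|nnR] := boolP (right_regular_group <| G).
  have ntP : P :!=: 1.
    apply: contraL (proper_subn prRG) => /eqP P1.
    by rewrite negbK -defG P1 mulg1.
  have [p Pp nt_p] := trivgPn _ ntP.
  have [Gp /eqP p1] := andP (etrans (esym (memP p)) Pp).
  exists p; last by rewrite {2}(fixS p).
  apply/setUP; left; rewrite !inE nt_p /=.
  have := norm_right_regular_Aut (subsetP (normal_norm nRG) p Gp) p1.
  by rewrite inE.
(* A normal subgroup fixing [1] fixes every point, by transitivity of the translations. *)
have coreP (Q : {group {perm gT}}) : Q \subset P -> Q <| G -> Q :=: 1.
  move=> sQP nQG; apply/trivgP/subsetP=> q Qq; apply/set1P/permP=> x.
  have Gx : r x \in G by rewrite (subsetP sRG).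
  have : q ^ (r x)^-1 \in P.
    by rewrite (subsetP sQP) // memJ_norm // groupV (subsetP (normal_norm nQG)).
  rewrite memP => /andP[_]; rewrite /conjg invgK !permM rE mul1g -rV rE perm1.
  by rewrite (can2_eq (mulgKV x) (mulgK x)) mul1g => /eqP.
have [H [sHZ ntH Hwreath]] :=
  maximal_abelian_generalized_wreath maxR right_regular_abelian nnR defG tiRP coreP.
(* The copy in [gT] of the central part of the regular group. *)
pose K := [set x | r x \in 'C(G)].
have gK : group_set K.
  apply/group_setP; split=> [|x y].
    by rewrite inE (_ : r 1 = 1) ?group1 //; apply/permP=> x; rewrite rE mulg1 perm1.
  by rewrite !inE => Kx Ky; rewrite rM groupM.
have [h_ Hh nt_h] := trivgPn _ ntH.
have /setIP[/right_regularP[h def_h] Zh] := subsetP sHZ _ Hh.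
exists (off_shift (group gK) h).
  apply/setUP; right; apply/imsetP; exists (group gK, h) => //.
  rewrite inE /=; apply/and3P; split.
  - rewrite properEneq subsetT andbT; apply: contra nnR => /eqP KT.
    rewrite /normal sRG cents_norm // centsC; apply/subsetP=> _ /right_regularP[x ->].
    by have := in_setT x; rewrite -KT inE.
  - by rewrite inE -def_h.
  apply: contra nt_h => /eqP h1; rewrite def_h h1; apply/eqP/permP=> x.
  by rewrite permE mulg1 perm1.
rewrite eqEcard card_imset ?leqnn ?andbT; last exact: perm_inj.
apply/subsetP=> _ /imsetP[x Sx ->]; rewrite permE /off_shift_fun.
case: ifP => // /norP[Kx _].
have : h_ * r x \in P :* r x * P.
  by apply: Hwreath => //; rewrite !inE r_regular andbT; rewrite inE in Kx.
(* Evaluating [r h * r x = p1 * r x * p2] at [1] gives [h * x = p2 x], and [p2] preserves [S]. *)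
case/mulsgP=> _ p2 /rcosetP[p1 Pp1 ->] Pp2 /(congr1 (fun s : {perm gT} => s 1)).
rewrite def_h !permM !rE mul1g => ->.
have [_ /eqP->] := andP (etrans (esym (memP p1)) Pp1).
have [Gp2 /eqP p21] := andP (etrans (esym (memP p2)) Pp2).
by rewrite mul1g (fixS p2) // imset_f.
Qed.

(** Corrected by a translation, the isomorphism fixes [1]. It pulls translations back to
    automorphisms of [Cay(S)], which are translations, so it normalises the regular group. *)
Lemma DRR_class_Aut S T :
  is_DRR S -> cay_iso S T -> exists2 a, a \in Aut [set: gT] & T = a @: S.
Proof.
move=> /eqP drrS /existsP[q isoq].
pose p := q * r (q 1)^-1.
have Rr a : r a \in cay_aut T by rewrite (subsetP (right_regular_sub_cay_aut T)).
have isop : cay_isom S T p.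
  by apply: cay_isomM isoq _; have := Rr (q 1)^-1; rewrite inE.
have p1 : p 1 = 1 by rewrite permM rE mulgV.
exists p; last exact: cay_isom_imset.
apply: norm_right_regular_Aut => //.
rewrite -groupV; apply/normP/eqP; rewrite eqEcard cardJg leqnn andbT -{2}drrS.
apply/subsetP=> _ /imsetP[s Rs ->]; rewrite inE /conjg invgK.
have := subsetP (right_regular_sub_cay_aut T) s Rs; rewrite inE => isos.
exact: cay_isomM isop (cay_isomM isos (cay_isomV isop)).
Qed.

End CayleyAutomorphisms.

(** * Counting classes *)

Lemma leq_card_bigcup (I T : finType) (A : {set I}) (F : I -> {set T}) :
  (#|\bigcup_(i in A) F i| <= \sum_(i in A) #|F i|)%N.
Proof.
elim/big_rec2: _ => [|i m U _ leUm]; first by rewrite cards0.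
by apply: leq_trans (leq_card_setU _ _) _; rewrite leq_add2l.
Qed.

Section Counting.

Variable gT : finGroupType.
Hypothesis abT : abelian [set: gT].

Let n := #|gT|.
Let k := trunc_log 2 n.
Let bad := [set S : {set gT} | ~~ is_DRR S].

Let n_gt0 : (0 < n)%N. Proof. by rewrite /n -cardsT cardG_gt0. Qed.

Lemma cay_iso_refl (S : {set gT}) : S \in cay_class S.
Proof.
by rewrite inE; apply/existsP; exists 1; have := group1 (cay_aut_group S); rewrite inE.
Qed.

Lemma card_nonDRR : (#|bad| <= n ^ k.+2 * 2 ^ (3 * n %/ 4))%N.
Proof.
apply: leq_trans (_ : #|half_moving_perms gT| * 2 ^ (3 * n %/ 4) <= _)%N; last first.
  exact: leq_mul (card_half_moving_perms gT) (leqnn _).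
rewrite -sum_nat_const.
have sBU : bad \subset
    \bigcup_(s in half_moving_perms gT) [set S : {set gT} | s @: S == S].
  apply/subsetP=> S; rewrite inE => /(nonDRR_stable abT)[s Hs sS].
  by apply/bigcupP; exists s => //; rewrite inE.
apply: leq_trans (subset_leq_card sBU) _.
apply: leq_trans (leq_card_bigcup _ _) _.
apply: leq_sum => s Hs.
by apply: card_stable_sets_half; apply: half_moving_perms_fix.
Qed.

Lemma DRR_classes_sub : DRR_classes gT \subset cayley_classes gT.
Proof. by apply/subsetP=> _ /imsetP[S _ ->]; apply: imset_f. Qed.

Lemma card_cayley_classes_le : (#|cayley_classes gT| <= #|DRR_classes gT| + #|bad|)%N.
Proof.
apply: leq_trans (_ : _ <= #|DRR_classes gT :|: @cay_class gT @: bad|)%N _; last first.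
  by apply: leq_trans (leq_card_setU _ _) _; rewrite leq_add2l leq_imset_card.
apply/subset_leq_card/subsetP=> _ /imsetP[S _ ->].
by apply/setUP; have [drrS|drrS] := boolP (is_DRR S); [left|right];
   apply: imset_f; rewrite inE.
Qed.

(** The DRR classes cover the DRR sets, and each lies in an orbit of [Aut [set: gT]]. *)
Lemma card_DRR_classes_ge : (2 ^ n <= #|bad| + #|DRR_classes gT| * n ^ k)%N.
Proof.
have <- : #|{set gT}| = (2 ^ n)%N by rewrite -cardsT -powersetT card_powerset cardsT.
rewrite -(cardC (mem bad)) leq_add2l -sum_nat_const.
apply: leq_trans (_ : _ <= #|\bigcup_(X in DRR_classes gT) X|)%N _.
  apply/subset_leq_card/subsetP=> S; rewrite !inE negbK => drrS.
  by apply/bigcupP; exists (cay_class S); [rewrite imset_f ?inE | exact: cay_iso_refl].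
apply: leq_trans (leq_card_bigcup _ _) _.
apply: leq_sum => X /imsetP[S]; rewrite inE => drrS ->.
apply: leq_trans (card_Aut_le [set: gT]%G).
apply: leq_trans (leq_imset_card (fun a : {perm gT} => a @: S) _).
apply/subset_leq_card/subsetP=> T; rewrite inE => /(DRR_class_Aut drrS)[a Aa ->].
exact: imset_f.
Qed.

Lemma few_nonDRR_classes (m : nat) : (m < n)%N -> (11 <= k)%N ->
  (m * (#|cayley_classes gT| - #|DRR_classes gT|) < #|cayley_classes gT|)%N.
Proof.
move=> lt_mn le_k; set c := #|_|; set d := #|_|.
have le_dc : (d <= c)%N by apply: subset_leq_card DRR_classes_sub.
have nk_gt0 : (0 < n ^ k)%N by rewrite expn_gt0 n_gt0.
(* With [card_DRR_classes_ge] this yields [m * #|bad| < d], while [c - d <= #|bad|]. *)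
have lt_bad : (#|bad| * (m * n ^ k + 1) < 2 ^ n)%N.
  (* The polynomial factor is at most [n ^ (2 * k + 3)] with [n <= 2 ^ (k + 1)], whence the product;
     the 4 comes from [n - 3 * n %/ 4 >= n / 4]. At [j = 11] it reads 1200 < 2048. *)
  have lt_k j : (11 <= j -> 4 * ((j + 1) * (2 * j + 3)) < 2 ^ j)%N.
    elim: j => // j IHj; rewrite leq_eqVlt => /predU1P[[<-]//|le_j].
    by have := IHj le_j; rewrite expnS; move: (2 ^ j)%N => x; nia.
  have lt_n : ((k + 1) * (2 * k + 3) < n - 3 * n %/ 4)%N.
    have := lt_k k le_k; have := trunc_logP (p := 2) isT n_gt0; rewrite -/k; lia.
  have le_n : (n <= 2 ^ (k + 1))%N.
    by apply: ltnW; rewrite addn1; apply: trunc_log_ltn.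
  have le_mn : (m * n ^ k + 1 <= n ^ k.+1)%N by rewrite expnS; nia.
  apply: leq_ltn_trans (leq_mul card_nonDRR le_mn) _.
  rewrite mulnAC -expnD.
  have le1 : (n ^ (k.+2 + k.+1) <= 2 ^ ((k + 1) * (2 * k + 3)))%N.
    rewrite expnM; apply: leq_trans (_ : n ^ (2 * k + 3) <= _)%N.
      by rewrite leq_pexp2l //; lia.
    by rewrite leq_exp2r //; lia.
  apply: leq_ltn_trans (leq_mul le1 (leqnn _)) _.
  by rewrite -expnD ltn_exp2l //; lia.
have := card_cayley_classes_le; have := card_DRR_classes_ge; rewrite -/c -/d.
move: lt_bad nk_gt0; move: (n ^ k)%N (2 ^ n)%N #|bad| => u v b.
move=> lt_bad u_gt0 le_v le_c.
have : (m * (c - d) <= m * b)%N by rewrite leq_mul2l; lia.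
suff : (m * b < c)%N by lia.
rewrite -(ltn_pmul2r u_gt0).
have : (d * u <= c * u)%N by rewrite leq_mul2r le_dc orbT.
nia.
Qed.

End Counting.

(** * The limit of the ratio *)

Import Order.TTheory GRing.Theory Num.Theory.
Local Open Scope ring_scope.

Theorem theorem6p1 :
  forall eps : rat, 0 < eps ->
  exists N : nat, forall gT : finGroupType,
    abelian [set: gT] -> (N <= #|gT|)%N ->
    `| (#|DRR_classes gT|%:R / #|cayley_classes gT|%:R : rat) - 1 | < eps.
Proof.
move=> eps eps_gt0; pose m := Num.bound eps^-1.
have lt_m : 1 < m%:R * eps.
  by rewrite -ltr_pdivrMr // mul1r archi_boundP // invr_ge0 ltW.
(* The two bounds supply [m < n] and [11 <= trunc_log 2 n]. *)
exists (maxn m.+1 (2 ^ 11)) => gT abT; rewrite geq_max => /andP[lt_mn le_n].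
have := few_nonDRR_classes abT lt_mn (trunc_log_max (ltnSn 1) le_n).
have := subset_leq_card (DRR_classes_sub gT).
set c := #|cayley_classes gT|; set d := #|DRR_classes gT| => le_dc lt_c.
have c_gt0 : 0 < c%:R :> rat by rewrite ltr0n; lia.
rewrite distrC ger0_norm; last by rewrite subr_ge0 ler_pdivrMr // mul1r ler_nat.
have -> : 1 - d%:R / c%:R = (c%:R - d%:R) / c%:R :> rat.
  by rewrite mulrBl divff ?lt0r_neq0.
rewrite ltr_pdivrMr // -natrB //.
have: (m * (c - d))%:R < c%:R :> rat by rewrite ltr_nat.
(* Since [1 < m * eps], one has [c - d <= m * (c - d) * eps < eps * c]. *)
rewrite natrM -(ltr_pM2r eps_gt0) [_ * c%:R]mulrC; apply: le_lt_trans.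
by rewrite mulrAC ler_peMl ?ler0n // ltW.
Qed.
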